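(* Let $A$ and $B$ be finite-dimensional unital algebras over $\mathbb C$ with a non-degenerate bilinear pairing $A\times B\to\mathbb C$, $(a,b)\mapsto\langle a,b\rangle$, and consider the coproducts and counits on $A$ and $B$ induced by the pairing. Assume that there is a faithful left integral $\varphi$ on $A$ and that its antipode $S:A\to A$ is an anti-isomorphism of the algebra $A$. Define $\psi:B\to\mathbb C$ by $\psi(b)=\varepsilon(c)$ when $b=\varphi(\,\cdot\,c)$ with $c\in A$, i.e. when $\langle a,b\rangle=\varphi(ac)$ for all $a\in A$. Then $\psi$ is a faithful right integral on $B$ with antipode $S':B\to B$ given as the adjoint of $S$, that is $\langle a,S'(b)\rangle=\langle S(a),b\rangle$ for all $a\in A$, $b\in B$. The map $S'$ is an anti-isomorphism of the algebra $B$.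
   Context: Non-degenerate means: $\langle a,b\rangle=0$ for all $b$ implies $a=0$, and $\langle a,b\rangle=0$ for all $a$ implies $b=0$. The induced coproducts (coassociative linear maps, not assumed multiplicative or unital) are defined by $\langle \Delta(a),b\otimes b'\rangle=\langle a,bb'\rangle$ on $A$ and $\langle a\otimes a',\Delta(b)\rangle=\langle aa',b\rangle$ on $B$; the induced counits are $\varepsilon(a)=\langle a,1\rangle$ and $\varepsilon(b)=\langle 1,b\rangle$. $\iota$ denotes the identity map. A linear functional $\omega$ on an algebra $A$ is faithful if $\omega(ac)=0$ for all $c$ implies $a=0$, and $\omega(ac)=0$ for all $a$ implies $c=0$. When $\varphi$ is faithful on $A$, every $b\in B$ is of the form $\varphi(\,\cdot\,c)$ for a unique $c\in A$. For an algebra $A$ with coproduct $\Delta$, a linear functional $\varphi$ on $A$ is a left integral if there is a linear map $S:A\to A$ with $S((\iota\otimes\varphi)(\Delta(a)(1\otimes c)))=(\iota\otimes\varphi)((1\otimes a)\Delta(c))$ for all $a,c\in A$. A linear functional $\psi$ is a right integral if there is a linear map $S':A\to A$ with $S'((\psi\otimes\iota)((c\otimes 1)\Delta(a)))=(\psi\otimes\iota)(\Delta(c)(a\otimes 1))$ for all $a,c\in A$. If the integral is faithful, the map $S$ (resp. $S'$) is unique and is called its antipode. The same definitions apply to $B$. An anti-isomorphism of an algebra is a bijective linear map $S$ with $S(xy)=S(y)S(x)$. *)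

(* Defs.v *)
From mathcomp Require Import all_boot all_algebra all_field.
From mathcomp Require Import boolp classical_sets ring.

Set Implicit Arguments.
Unset Strict Implicit.
Unset Printing Implicit Defensive.

Import GRing.Theory.
Local Open Scope ring_scope.

Section Tensor.
Variable K : fieldType.

Definition ebasis (U : vectType K) (i : 'I_(\dim {:U})) : U :=
  (vbasis {:U})`_i.

(* U (x) V in coordinates: the matrix t stands for
   \sum_(i, j) t i j *: (e_i (x) e_j), where e_i = ebasis i.  The universal
   property of this model is tlift_tpure, tlift_linear, tensor_sum_pure. *)
Definition tensor (U V : vectType K) := 'M[K]_(\dim {:U}, \dim {:V}).

Definition tpure (U V : vectType K) (u : U) (v : V) : tensor U V :=
  \matrix_(i, j) (coord (vbasis {:U}) i u * coord (vbasis {:V}) j v).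

(* The linear map on U (x) V induced by a bilinear map f on U x V. *)
Definition tlift (U V : vectType K) (W : lmodType K) (f : U -> V -> W)
    (t : tensor U V) : W :=
  \sum_i \sum_j t i j *: f (ebasis i) (ebasis j).

Lemma ebasis_sum (U : vectType K) (u : U) :
  u = \sum_i coord (vbasis {:U}) i u *: ebasis i.
Proof. exact: coord_vbasis (memvf u). Qed.

Lemma coord_ebasis (U : vectType K) (i j : 'I_(\dim {:U})) :
  coord (vbasis {:U}) i (ebasis j) = (i == j)%:R.
Proof. rewrite eq_sym coord_free //; exact: basis_free (vbasisP _). Qed.

Lemma linear_ebasis (U : vectType K) (W : lmodType K) (f : U -> W) :
  linear f -> forall u, f u = \sum_i coord (vbasis {:U}) i u *: f (ebasis i).
Proof.
move=> fl u.
have addf x y : f (x + y) = f x + f y by have := fl 1 x y; rewrite !scale1r.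
have f0 : f 0 = 0 by apply: (addrI (f 0)); rewrite -addf !addr0.
rewrite [in LHS](ebasis_sum u) (big_morph f addf f0).
by apply: eq_bigr => i _; have := fl (coord (vbasis {:U}) i u) (ebasis i) 0;
  rewrite f0 !addr0.
Qed.

Lemma tlift_tpure (U V : vectType K) (W : lmodType K) (f : U -> V -> W) :
  (forall v, linear (f^~ v)) -> (forall u, linear (f u)) ->
  forall u v, tlift f (tpure u v) = f u v.
Proof.
move=> fl fr u v; rewrite (linear_ebasis (fl v)).
apply: eq_bigr => i _; rewrite (linear_ebasis (fr _) v) scaler_sumr.
by apply: eq_bigr => j _; rewrite scalerA mxE.
Qed.

Lemma tlift_linear (U V : vectType K) (W : lmodType K) (f : U -> V -> W) :
  linear (tlift f).
Proof.
move=> a s t; rewrite /tlift scaler_sumr -big_split; apply: eq_bigr => i _ /=.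
rewrite scaler_sumr -big_split; apply: eq_bigr => j _ /=.
by rewrite !mxE scalerDl scalerA.
Qed.

Lemma tpure_ebasis (U V : vectType K) i j :
  tpure (ebasis i : U) (ebasis j : V) = delta_mx i j.
Proof. by apply/matrixP => k l; rewrite !mxE !coord_ebasis -natrM mulnb. Qed.

Lemma tensor_sum_pure (U V : vectType K) (t : tensor U V) :
  t = \sum_i \sum_j t i j *: tpure (ebasis i) (ebasis j).
Proof.
rewrite [LHS]matrix_sum_delta; apply: eq_bigr => i _; apply: eq_bigr => j _.
by rewrite tpure_ebasis.
Qed.

End Tensor.

Section Algebra.
Variables (K : fieldType) (A : falgType K).

Definition tmul (s t : tensor A A) : tensor A A :=
  tlift (fun a a' => tlift (fun c c' => tpure (a * c) (a' * c')) t) s.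

Lemma tmul_tpure a a' c c' :
  tmul (tpure a a') (tpure c c') = tpure (a * c) (a' * c').
Proof.
have purel v : linear (fun u : A => tpure u v : tensor A A).
  by move=> k x y; apply/matrixP => i j; rewrite !mxE linearP mulrDl -!mulrA.
have purer (u : A) : linear (fun v : A => tpure u v : tensor A A).
  by move=> k x y; apply/matrixP => i j; rewrite !mxE linearP mulrDr mulrCA.
have inner u u' v v' :
    tlift (fun c c' => tpure (u * c) (u' * c')) (tpure v v') =
    tpure (u * v) (u' * v') :> tensor A A.
  apply: (tlift_tpure (f := fun c c' => tpure (u * c) (u' * c'))) => w k x y.
    by rewrite mulrDr -scalerAr purel.
  by rewrite mulrDr -scalerAr purer.
rewrite /tmul tlift_tpure ?inner // => w k x y; rewrite !inner.
  by rewrite mulrDl -scalerAl purel.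
by rewrite mulrDl -scalerAl purer.
Qed.

(* iota (x) w and w (x) iota, with A (x) K and K (x) A identified with A. *)
Definition slice_r (w : A -> K) (t : tensor A A) : A :=
  tlift (fun a a' => w a' *: a) t.
Definition slice_l (w : A -> K) (t : tensor A A) : A :=
  tlift (fun a a' => w a *: a') t.

Definition faithful (w : A -> K) :=
  (forall a, (forall c, w (a * c) = 0) -> a = 0) /\
  (forall c, (forall a, w (a * c) = 0) -> c = 0).

Definition anti_isomorphism (S : A -> A) :=
  [/\ linear S, bijective S & forall x y, S (x * y) = S y * S x].

Variable Delta : A -> tensor A A.

Definition left_antipode (phi : A -> K) (S : A -> A) :=
  linear S /\
  forall a c, S (slice_r phi (tmul (Delta a) (tpure 1 c))) =
              slice_r phi (tmul (tpure 1 a) (Delta c)).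

Definition left_integral (phi : A -> K) :=
  scalar phi /\ exists S : A -> A, left_antipode phi S.

Definition right_antipode (psi : A -> K) (S : A -> A) :=
  linear S /\
  forall a c, S (slice_l psi (tmul (tpure c 1) (Delta a))) =
              slice_l psi (tmul (Delta c) (tpure a 1)).

Definition right_integral (psi : A -> K) :=
  scalar psi /\ exists S : A -> A, right_antipode psi S.

End Algebra.

Section Pairing.
Variables (K : fieldType) (A B : falgType K) (p : A -> B -> K).

Definition nondegenerate_pairing :=
  (forall a, (forall b, p a b = 0) -> a = 0) /\
  (forall b, (forall a, p a b = 0) -> b = 0).

(* <a (x) a', b (x) b'> = <a, b> <a', b'>, extended bilinearly. *)
Definition tpairing (s : tensor A A) (t : tensor B B) : K :=
  tlift (W := K^o)
    (fun a a' => tlift (W := K^o) (fun b b' => p a b * p a' b') t) s.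

(* For p bilinear and nondegenerate the sets below are singletons
   (coproductA_spec, coproductA_uniq and their analogues for B), so the
   default value of xget is never used. *)
Definition coproductA (a : A) : tensor A A :=
  xget 0 [set t | forall b b', tpairing t (tpure b b') = p a (b * b')].
Definition coproductB (b : B) : tensor B B :=
  xget 0 [set t | forall a a', tpairing (tpure a a') t = p (a * a') b].

Definition counitA (a : A) : K := p a 1.

(* Exactly one such c exists if p is bilinear and nondegenerate and phi is
   linear and faithful (dual_element_exists, dual_integral_spec). *)
Definition dual_integral (phi : A -> K) (b : B) : K :=
  counitA (xget 0 [set c | forall a, p a b = phi (a * c)]).

End Pairing.

Section PairingTheory.
Variables (K : fieldType) (A B : falgType K) (p : A -> B -> K).
Hypothesis p_linl : forall b, scalar (p^~ b).
Hypothesis p_linr : forall a, scalar (p a).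
Hypothesis p_nondeg : nondegenerate_pairing p.

Let G : 'M[K]_(\dim {:A}, \dim {:B}) :=
  \matrix_(i, j) p (ebasis i) (ebasis j).

Let pE a b : p a b = \sum_i \sum_j coord (vbasis {:A}) i a *
  coord (vbasis {:B}) j b * G i j.
Proof.
rewrite (linear_ebasis (W := K^o) (f := p^~ b) (@p_linl b)).
apply: eq_bigr => i _.
rewrite (linear_ebasis (W := K^o) (f := p _) (@p_linr _)) scaler_sumr.
by apply: eq_bigr => j _; rewrite scalerA mxE.
Qed.

Let coord_sum (U : vectType K) (f : 'I_(\dim {:U}) -> K) i :
  coord (vbasis {:U}) i (\sum_j f j *: ebasis j) = f i.
Proof.
rewrite linear_sum (bigD1 i) //= big1 ?addr0 => [|j ji].
  by rewrite linearZ /= coord_ebasis eqxx mulr1.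
by rewrite linearZ /= coord_ebasis eq_sym (negPf ji) mulr0.
Qed.

Let G_free : row_free G.
Proof.
rewrite -kermx_eq0; apply/rowV0P => u /sub_kermxP uG.
have a0 : \sum_i u 0 i *: ebasis i = 0 :> A.
  apply: p_nondeg.1 => b; rewrite pE exchange_big big1 // => j _.
  under eq_bigr => i _ do rewrite coord_sum mulrAC.
  by rewrite -mulr_suml; have /matrixP/(_ 0 j) := uG; rewrite !mxE => ->;
    rewrite mul0r.
by apply/rowP => i; rewrite mxE -(coord_sum (u 0) i) a0 linear0.
Qed.

Let G_full : row_full G.
Proof.
rewrite /row_full -mxrank_tr -[_ == _]/(row_free G^T) -kermx_eq0.
apply/rowV0P => u /sub_kermxP uG.
have b0 : \sum_i u 0 i *: ebasis i = 0 :> B.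
  apply: p_nondeg.2 => a; rewrite pE big1 // => i _.
  under eq_bigr => j _ do rewrite coord_sum -mulrA.
  rewrite -mulr_sumr; have /matrixP/(_ 0 i) := uG; rewrite !mxE.
  by under eq_bigr => j _ do rewrite mxE; move=> ->; rewrite mulr0.
by apply/rowP => i; rewrite mxE -(coord_sum (u 0) i) b0 linear0.
Qed.

Let G_inv : exists2 H, G *m H = 1%:M & H *m G = 1%:M.
Proof. by exists (pinvmx G); rewrite ?mulmxVp ?mulVpmx. Qed.

Let tpairingE (s : tensor A A) (t : tensor B B) :
  tpairing p s t = \sum_k \sum_l (G^T *m s *m G) k l * t k l.
Proof.
pose F i j k l := s i j * (t k l * (G i k * G j l)).
transitivity (\sum_i \sum_j \sum_k \sum_l F i j k l).
  apply: eq_bigr => i _; apply: eq_bigr => j _.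
  rewrite scaler_sumr; apply: eq_bigr => k _.
  by rewrite scaler_sumr; apply: eq_bigr => l _; rewrite /F !mxE.
transitivity (\sum_k \sum_l \sum_j \sum_i F i j k l).
  rewrite exchange_big /=.
  under eq_bigr => j _ do rewrite exchange_big /=.
  rewrite exchange_big /=; apply: eq_bigr => k _.
  under eq_bigr => j _ do rewrite exchange_big /=.
  by rewrite exchange_big.
apply: eq_bigr => k _; apply: eq_bigr => l _.
rewrite mxE mulr_suml; apply: eq_bigr => j _.
rewrite !mxE !mulr_suml; apply: eq_bigr => i _.
by rewrite /F !mxE; ring.
Qed.

Let tpairing_ebasis (t : tensor A A) k l :
  tpairing p t (tpure (ebasis k) (ebasis l)) = (G^T *m t *m G) k l.
Proof.
rewrite tpairingE tpure_ebasis (bigD1 k) //= (bigD1 l) //=.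
rewrite [delta_mx _ _ _ _]mxE !eqxx mulr1.
rewrite !big1 ?addr0 // => [k' k'k|l' l'l]; rewrite ?big1 // => *;
by rewrite [delta_mx _ _ _ _]mxE ?(negPf k'k) ?(negPf l'l) ?andbF mulr0.
Qed.

Lemma coproductA_uniq a (s s' : tensor A A) :
  (forall b b', tpairing p s (tpure b b') = p a (b * b')) ->
  (forall b b', tpairing p s' (tpure b b') = p a (b * b')) -> s = s'.
Proof.
move=> sP s'P; have E : G^T *m s *m G = G^T *m s' *m G.
  by apply/matrixP => k l; rewrite -!tpairing_ebasis sP s'P.
have [H GH _] := G_inv; have := congr1 (fun M => H^T *m (M *m H)) E.
rewrite -!mulmxA GH !mulmx1 !mulmxA -trmx_mul GH.
by rewrite trmx1 !mul1mx.
Qed.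

Lemma coproductA_spec a b b' :
  tpairing p (coproductA p a) (tpure b b') = p a (b * b').
Proof.
suff [t tP] : exists t, forall b b', tpairing p t (tpure b b') = p a (b * b').
  by rewrite /coproductA; case: xgetP => [y _ /= ->|/(_ t)].
pose N := \matrix_(k, l) p a (ebasis k * ebasis l).
have [H _ HG] := G_inv; pose t : tensor A A := H^T *m N *m H.
exists t => {}b {}b'; rewrite tpairingE.
have -> : G^T *m t *m G = N.
  rewrite /t -!mulmxA HG mulmx1 !mulmxA -trmx_mul HG.
  by rewrite trmx1 mul1mx.
have pml v : scalar (fun u => p a (u * v)).
  by move=> c x y; rewrite mulrDl -scalerAl p_linr.
have pmr u : scalar (fun v => p a (u * v)).
  by move=> c x y; rewrite mulrDr -scalerAr p_linr.
rewrite (linear_ebasis (W := K^o) (pml b')); apply: eq_bigr => k _.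
rewrite (linear_ebasis (W := K^o) (pmr _)) scaler_sumr.
by apply: eq_bigr => l _; rewrite !mxE scalerA mulrC.
Qed.

Lemma dual_integral_spec (phi : A -> K) b c :
  scalar phi -> faithful phi ->
  (forall a, p a b = phi (a * c)) -> dual_integral p phi b = counitA p c.
Proof.
move=> phi_lin phi_f cP; congr (counitA p _); apply: xget_unique => // c' c'P.
apply/eqP; rewrite -subr_eq0; apply/eqP/phi_f.2 => a.
have := phi_lin (-1) (a * c) (a * c').
by rewrite -cP -c'P scaleN1r -mulrN -mulrDr [- c + c']addrC mulN1r addNr.
Qed.

Lemma dual_element_exists (phi : A -> K) b :
  scalar phi -> faithful phi -> exists c, forall a, p a b = phi (a * c).
Proof.
move=> phi_lin phi_f.
have pml v : scalar (fun u => phi (u * v)).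
  by move=> c x y; rewrite mulrDl -scalerAl phi_lin.
have pmr u : scalar (fun v => phi (u * v)).
  by move=> c x y; rewrite mulrDr -scalerAr phi_lin.
pose F := \matrix_(j, i) phi (ebasis i * ebasis j : A).
have F_unit : F \in unitmx.
  rewrite -row_free_unit -kermx_eq0; apply/rowV0P => u /sub_kermxP uF.
  have c0 : \sum_j u 0 j *: ebasis j = 0 :> A.
    apply: phi_f.2 => a; rewrite (linear_ebasis (W := K^o) (pml _)).
    rewrite big1 // => i _; rewrite (linear_ebasis (W := K^o) (pmr _)).
    have /matrixP/(_ 0 i) := uF; rewrite !mxE => E.
    transitivity (coord (vbasis {:A}) i a *: (0 : K^o)); last exact: scaler0.
    congr (_ *: _); rewrite -[RHS]E; apply: eq_bigr => j _.
    by rewrite coord_sum mxE.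
  by apply/rowP => i; rewrite mxE -(coord_sum (u 0) i) c0 linear0.
pose u := (\row_i p (ebasis i) b) *m invmx F.
exists (\sum_j u 0 j *: ebasis j) => a.
rewrite (linear_ebasis (W := K^o) (f := p^~ b) (@p_linl b)).
rewrite (linear_ebasis (W := K^o) (pml _)).
apply: eq_bigr => i _ /=; congr (_ * _).
rewrite (linear_ebasis (W := K^o) (pmr _)).
have := mulmxKV F_unit (\row_i p (ebasis i) b).
move=> /matrixP/(_ 0 i); rewrite -/u !mxE => <-.
by apply: eq_bigr => j _; rewrite coord_sum [F j i]mxE.
Qed.

End PairingTheory.

Section PairingTheoryB.
Variables (K : fieldType) (A B : falgType K) (p : A -> B -> K).
Hypothesis p_linl : forall b, scalar (p^~ b).
Hypothesis p_linr : forall a, scalar (p a).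
Hypothesis p_nondeg : nondegenerate_pairing p.

Let q : B -> A -> K := fun b a => p a b.

Let q_nondeg : nondegenerate_pairing q.
Proof. by case: p_nondeg. Qed.

Let tpairingC (s : tensor A A) (t : tensor B B) :
  tpairing p s t = tpairing q t s.
Proof.
pose F i j k l := s i j * (t k l * (p (ebasis i) (ebasis k) *
                                    p (ebasis j) (ebasis l))).
transitivity (\sum_i \sum_j \sum_k \sum_l F i j k l).
  apply: eq_bigr => i _; apply: eq_bigr => j _.
  rewrite scaler_sumr; apply: eq_bigr => k _.
  by rewrite scaler_sumr.
transitivity (\sum_k \sum_l \sum_i \sum_j F i j k l).
  under eq_bigr => i _ do rewrite exchange_big /=.
  rewrite exchange_big /=; apply: eq_bigr => k _.
  under eq_bigr => i _ do rewrite exchange_big /=.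
  by rewrite exchange_big.
apply: eq_bigr => k _; apply: eq_bigr => l _.
rewrite scaler_sumr; apply: eq_bigr => i _.
by rewrite scaler_sumr; apply: eq_bigr => j _; exact: mulrCA.
Qed.

Lemma coproductB_uniq b (t t' : tensor B B) :
  (forall a a', tpairing p (tpure a a') t = p (a * a') b) ->
  (forall a a', tpairing p (tpure a a') t' = p (a * a') b) -> t = t'.
Proof.
move=> tP t'P.
by apply: (coproductA_uniq (p := q) p_linr p_linl q_nondeg (a := b)) => a a';
  rewrite -tpairingC ?tP ?t'P.
Qed.

Lemma coproductB_spec b a a' :
  tpairing p (tpure a a') (coproductB p b) = p (a * a') b.
Proof.
suff [t tP] : exists t, forall a a', tpairing p (tpure a a') t = p (a * a') b.
  by rewrite /coproductB; case: xgetP => [y _ /= ->|/(_ t)].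
exists (coproductA q b) => x y; rewrite tpairingC.
exact: (coproductA_spec (p := q) p_linr p_linl q_nondeg).
Qed.

End PairingTheoryB.

(* Main.v *)
(** Write [F c] for the element of [B] with [<a, F c> = phi (a * c)], and
    [c <| b] for the element of [A] with [<c <| b, b'> = <c, b * b'>].  Paired
    with [b], the antipode relation for [S] becomes [S' b * F c = F (c <| b)]
    for the adjoint [S'] of [S].  Since [F] is onto and [<|] is a right action,
    [S'] reverses products; applying [psi] gives [psi (S' b * F c) = <c, b>],
    which makes [psi] faithful.  Paired with [x], both sides of the antipode
    relation for [S'] at [(F d, S' b)] then equal [<S x * d, b>]; this is where
    [S] has to reverse products. *)
Require Import Defs.
From HB Require Import structures.
From mathcomp Require Import all_boot all_algebra all_field.
From mathcomp Require Import reals boolp.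
From mathcomp Require Import complex.
Set Implicit Arguments.
Unset Strict Implicit.

Import GRing.Theory.
Local Open Scope ring_scope.
Local Open Scope complex_scope.

(** * Maps out of a tensor product, and products with a pure tensor *)

Lemma eq_tlift (K : fieldType) (U V : vectType K) (W : lmodType K)
    (f g : U -> V -> W) (t : tensor U V) :
  (forall u v, f u v = g u v) -> tlift f t = tlift g t.
Proof.
by move=> fg; apply: eq_bigr => i _; apply: eq_bigr => j _; rewrite fg.
Qed.

Lemma linear_tlift (K : fieldType) (U V : vectType K) (W X : lmodType K)
    (h : W -> X) (f : U -> V -> W) (t : tensor U V) :
  linear h -> h (tlift f t) = tlift (fun u v => h (f u v)) t.
Proof.
move=> hl.
have hD x y : h (x + y) = h x + h y by have := hl 1 x y; rewrite !scale1r.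
have h0 : h 0 = 0 by apply: (addrI (h 0)); rewrite -hD !addr0.
have hZ k x : h (k *: x) = k *: h x by have := hl k x 0; rewrite h0 !addr0.
rewrite /tlift (big_morph h hD h0); apply: eq_bigr => i _.
by rewrite (big_morph h hD h0); apply: eq_bigr => j _; rewrite hZ.
Qed.

Lemma tmul_tpurer (K : fieldType) (A : falgType K) (s : tensor A A) (c c' : A) :
  tmul s (tpure c c') = tlift (fun a a' => tpure (a * c) (a' * c')) s.
Proof.
(* The expansion of [s] into pure tensors is itself a [tlift], so [linear_tlift] reduces the claim
   to [tmul_tpure]. *)
rewrite [in LHS](tensor_sum_pure s) -[X in tmul X]/(tlift _ s).
rewrite (linear_tlift (h := fun s => tmul s (tpure c c'))).
  by apply: eq_tlift => u v; rewrite tmul_tpure.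
exact: tlift_linear.
Qed.

Lemma tmul_tpurel (K : fieldType) (A : falgType K) (t : tensor A A) (c c' : A) :
  tmul (tpure c c') t = tlift (fun a a' => tpure (c * a) (c' * a')) t.
Proof.
rewrite [in LHS](tensor_sum_pure t) -[X in tmul _ X]/(tlift _ t).
rewrite (linear_tlift (h := tmul (tpure c c'))).
  by apply: eq_tlift => u v; rewrite tmul_tpure.
(* The second factor sits in the inner [tlift]: linearity is applied there first, then summed over
   the outer one. *)
move=> k x y; rewrite {1}/tmul.
rewrite (eq_tlift (g := fun a a' =>
  k *: tlift (fun d d' => tpure (a * d) (a' * d')) x
  + tlift (fun d d' => tpure (a * d) (a' * d')) y)); last first.
  by move=> u v; rewrite tlift_linear.
rewrite /tmul /tlift scaler_sumr -big_split; apply: eq_bigr => i _ /=.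
rewrite scaler_sumr -big_split; apply: eq_bigr => j _ /=.
by rewrite scalerDr !scalerA mulrC.
Qed.

(** * Slices of a tensor by a functional *)

Lemma scalar_scale (K : fieldType) (V : lmodType K) (f : V -> K) k v :
  scalar f -> f (k *: v) = k * f v.
Proof.
move=> fl; have f0 : f 0 = 0.
  by apply: (addIr (f 0)); rewrite -{1}[f 0]mul1r -fl scaler0 !add0r.
by rewrite -[k *: v]addr0 fl f0 addr0.
Qed.

Lemma slice_r_tpure (K : fieldType) (A : falgType K) (w : A -> K) (u v : A) :
  scalar w -> slice_r w (tpure u v) = w v *: u.
Proof.
move=> wl; rewrite /slice_r (tlift_tpure (f := fun a a' => w a' *: a)) //
    => x k y z.
  by rewrite scalerDr !scalerA mulrC.
by rewrite wl scalerDl scalerA.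
Qed.

Lemma slice_l_tpure (K : fieldType) (A : falgType K) (w : A -> K) (u v : A) :
  scalar w -> slice_l w (tpure u v) = w u *: v.
Proof.
move=> wl; rewrite /slice_l (tlift_tpure (f := fun a a' => w a *: a')) //
    => x k y z.
  by rewrite wl scalerDl scalerA.
by rewrite scalerDr !scalerA mulrC.
Qed.

(** This and its three variants bring every side of the two antipode relations to a single [tlift]
    over a coproduct, with [c] absorbed into the functional. *)
Lemma slice_r_mulr (K : fieldType) (A : falgType K) (w : A -> K)
    (t : tensor A A) (c : A) : scalar w ->
  slice_r w (tmul t (tpure 1 c)) = tlift (fun a a' => w (a' * c) *: a) t.
Proof.
move=> wl; rewrite tmul_tpurer (linear_tlift (h := slice_r w)).
  by apply: eq_tlift => u v; rewrite slice_r_tpure // mulr1.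
exact: tlift_linear.
Qed.

Lemma slice_r_mull (K : fieldType) (A : falgType K) (w : A -> K)
    (t : tensor A A) (c : A) : scalar w ->
  slice_r w (tmul (tpure 1 c) t) = tlift (fun a a' => w (c * a') *: a) t.
Proof.
move=> wl; rewrite tmul_tpurel (linear_tlift (h := slice_r w)).
  by apply: eq_tlift => u v; rewrite slice_r_tpure // mul1r.
exact: tlift_linear.
Qed.

Lemma slice_l_mulr (K : fieldType) (A : falgType K) (w : A -> K)
    (t : tensor A A) (c : A) : scalar w ->
  slice_l w (tmul t (tpure c 1)) = tlift (fun a a' => w (a * c) *: a') t.
Proof.
move=> wl; rewrite tmul_tpurer (linear_tlift (h := slice_l w)).
  by apply: eq_tlift => u v; rewrite slice_l_tpure // mulr1.
exact: tlift_linear.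
Qed.

Lemma slice_l_mull (K : fieldType) (A : falgType K) (w : A -> K)
    (t : tensor A A) (c : A) : scalar w ->
  slice_l w (tmul (tpure c 1) t) = tlift (fun a a' => w (c * a) *: a') t.
Proof.
move=> wl; rewrite tmul_tpurel (linear_tlift (h := slice_l w)).
  by apply: eq_tlift => u v; rewrite slice_l_tpure // mul1r.
exact: tlift_linear.
Qed.

(** * Functionals represented by a nondegenerate pairing *)

Lemma curry_injective (K : fieldType) (U V : vectType K)
    (p : U -> V -> K) :
  (forall u, scalar (p u)) -> (forall v, scalar (p^~ v)) ->
  (forall v, (forall u, p u v = 0) -> v = 0) ->
  exists2 f : 'Hom(V, 'rV[K]_(\dim {:U})),
    lker f == 0%VS & forall v i, f v 0 i = p (ebasis i) v.
Proof.
move=> pr pl p0; pose g v := \row_(i < \dim {:U}) p (ebasis i) v.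
have gl : linear g by move=> k x y; apply/rowP => i; rewrite !mxE pr.
pose gL : {linear V -> 'rV[K]_(\dim {:U})} :=
  HB.pack g (GRing.isLinear.Build _ _ _ _ g gl).
have gE v i : linfun gL v 0 i = p (ebasis i) v by rewrite lfunE mxE.
exists (linfun gL) => //; apply/eqP/eqP; rewrite -subv0; apply/subvP => v.
rewrite memv_ker => /eqP v0; rewrite memv0; apply/eqP/p0 => u.
rewrite (linear_ebasis (W := K^o) (pl v)) big1 // => i _.
by rewrite -gE v0 mxE scaler0.
Qed.

(** Dimension count: injectivity of [g] gives dim U <= dim V, so the injective [f] fills the row
    vectors of length dim U, among them the values of [w] on the basis. *)
Lemma functional_represented (K : fieldType) (U V : vectType K)
    (p : U -> V -> K) :
  (forall u, scalar (p u)) -> (forall v, scalar (p^~ v)) ->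
  (forall u, (forall v, p u v = 0) -> u = 0) ->
  (forall v, (forall u, p u v = 0) -> v = 0) ->
  forall w : U -> K, scalar w -> exists v, forall u, w u = p u v.
Proof.
move=> pr pl pu pv w wl.
have [f f0 fE] := curry_injective pr pl pv.
have [g g0 _] := curry_injective (p := fun v u => p u v) pl pr pu.
have fdim : \dim (limg f) = \dim {:V} by rewrite limg_dim_eq // (eqP f0) capv0.
have gdim : \dim (limg g) = \dim {:U} by rewrite limg_dim_eq // (eqP g0) capv0.
have ffull : limg f = fullv.
  apply/eqP; rewrite eqEdim subvf fdim dimvf /dim /= mul1n -gdim.
  by rewrite (leq_trans (dimvS (subvf _))) // dimvf /dim /= mul1n.
have /memv_imgP[v _ vE] : \row_(i < \dim {:U}) w (ebasis i) \in limg f.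
  by rewrite ffull memvf.
exists v => u; rewrite (linear_ebasis (W := K^o) wl).
rewrite [RHS](linear_ebasis (W := K^o) (pl v)).
by apply: eq_bigr => i _; rewrite -fE -vE mxE.
Qed.

(** * Slices of the induced coproducts under the pairing *)

Section Duality.
Variables (K : fieldType) (A B : falgType K) (p : A -> B -> K).
Hypothesis p_linl : forall b, scalar (p^~ b).
Hypothesis p_linr : forall a, scalar (p a).
Hypothesis p_nondeg : nondegenerate_pairing p.

Lemma pairing_injl (a a' : A) : (forall b, p a b = p a' b) -> a = a'.
Proof.
move=> E; apply/eqP; rewrite -subr_eq0; apply/eqP/p_nondeg.1 => b.
by rewrite addrC -scaleN1r p_linl E mulN1r addNr.
Qed.

Lemma pairing_injr (b b' : B) : (forall a, p a b = p a b') -> b = b'.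
Proof.
move=> E; apply/eqP; rewrite -subr_eq0; apply/eqP/p_nondeg.2 => a.
by rewrite addrC -scaleN1r p_linr E mulN1r addNr.
Qed.

Lemma repB (w : A -> K) : scalar w -> exists b, forall a, w a = p a b.
Proof. exact: (functional_represented p_linr p_linl p_nondeg.1 p_nondeg.2). Qed.

Lemma repA (w : B -> K) : scalar w -> exists a, forall b, w b = p a b.
Proof.
exact: (functional_represented (p := fun b a => p a b) p_linl p_linr
  p_nondeg.2 p_nondeg.1).
Qed.

Lemma tpairing_tpurer (s : tensor A A) (b b' : B) :
  tpairing p s (tpure b b') =
  tlift (W := K^o) (fun a a' => p a b * p a' b') s.
Proof.
apply: (eq_tlift (W := K^o)) => a a'.
rewrite (tlift_tpure (W := K^o) (f := fun b b' => p a b * p a' b')) //.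
  by move=> v k x y; rewrite p_linr mulrDl -mulrA.
by move=> v k x y; rewrite p_linr mulrDr mulrCA.
Qed.

Lemma tpairing_tpurel (t : tensor B B) (a a' : A) :
  tpairing p (tpure a a') t =
  tlift (W := K^o) (fun b b' => p a b * p a' b') t.
Proof.
rewrite /tpairing (tlift_tpure (W := K^o) (f := fun a a' =>
  tlift (W := K^o) (fun b b' => p a b * p a' b') t)) // => v k x y.
  rewrite /tlift scaler_sumr -big_split; apply: eq_bigr => i _ /=.
  rewrite scaler_sumr -big_split; apply: eq_bigr => j _ /=.
  rewrite p_linl mulrDl [LHS]mulrDr; congr (_ + _).
  by rewrite -mulrA [LHS]mulrCA.
rewrite /tlift scaler_sumr -big_split; apply: eq_bigr => i _ /=.
rewrite scaler_sumr -big_split; apply: eq_bigr => j _ /=.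
rewrite p_linl mulrDr [LHS]mulrDr; congr (_ + _).
by rewrite (mulrCA (p v _) k) [LHS]mulrCA.
Qed.

(** Both sides are the pairing of the coproduct of [a] with the pure tensor of [b] and [b'].
    Antipode relations thereby become identities between products. *)
Lemma pairing_slice_r (w : A -> K) (a : A) (b b' : B) :
  (forall x, w x = p x b') ->
  p (tlift (fun x x' => w x' *: x) (coproductA p a)) b = p a (b * b').
Proof.
move=> wE; rewrite (linear_tlift (X := K^o) (h := p^~ b)) //.
rewrite -(coproductA_spec p_linl p_linr p_nondeg) tpairing_tpurer.
apply: (eq_tlift (W := K^o)) => x x'.
by rewrite (scalar_scale _ _ (p_linl b)) wE mulrC.
Qed.

Lemma pairing_slice_l (w : B -> K) (a a' : A) (b : B) :
  (forall y, w y = p a' y) ->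
  p a (tlift (fun y y' => w y *: y') (coproductB p b)) = p (a' * a) b.
Proof.
move=> wE; rewrite (linear_tlift (X := K^o) (h := p a)) //.
rewrite -(coproductB_spec p_linl p_linr p_nondeg) tpairing_tpurel.
apply: (eq_tlift (W := K^o)) => y y'.
by rewrite (scalar_scale _ _ (p_linr a)) wE.
Qed.

(** * The dual integral and the adjoint of the antipode *)

Variable phi : A -> K.
Hypothesis phi_lin : scalar phi.
Hypothesis phi_faithful : faithful phi.
Variable S : A -> A.
Hypothesis S_antipode : left_antipode (coproductA p) phi S.
Hypothesis S_anti : anti_isomorphism S.

Let psi := dual_integral p phi.

Lemma dual_integral_faithful_right_antipode :
  [/\ scalar psi, faithful psi &
      exists S' : B -> B,
        [/\ forall (a : A) (b : B), p a (S' b) = p (S a) b,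
            right_antipode (coproductB p) psi S' &
            anti_isomorphism S']].
Proof.
have [S_lin [T ST TS] S_mul] := S_anti.
have phi_mull a : scalar (fun x => phi (a * x)).
  by move=> k x y; rewrite mulrDr -scalerAr phi_lin.
have phi_mulr a : scalar (fun x => phi (x * a)).
  by move=> k x y; rewrite mulrDl -scalerAl phi_lin.
have p_mulr a b : scalar (fun x => p a (b * x)).
  by move=> k x y; rewrite mulrDr -scalerAr p_linr.
have /choice[F FE] c : exists b, forall a, p a b = phi (a * c).
  by have [b bE] := repB (phi_mulr c); exists b => a; rewrite bE.
(* [E b] is the element that defines [psi b]; by [EK] and [FK], [E] is the inverse of [F]. *)
have /choice[E EE] b : exists c, forall a, p a b = phi (a * c).
  exact: dual_element_exists.
have EK b : F (E b) = b by apply: pairing_injr => a; rewrite FE EE.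
have psiF c : psi (F c) = p c 1.
  by apply: dual_integral_spec => // a; rewrite FE.
have F_lin : linear F.
  by move=> k x y; apply: pairing_injr => a; rewrite p_linr !FE phi_mull.
have FK c : E (F c) = c.
  apply/eqP; rewrite -subr_eq0; apply/eqP/phi_faithful.2 => a.
  by rewrite addrC -scaleN1r phi_mull -EE FE mulN1r addNr.
have psi_lin : scalar psi.
  by move=> k x y; rewrite -[x]EK -[y]EK -F_lin !psiF p_linl.
(* [R (c, b)] is [c <| b], uncurried so that one use of [choice] provides it. *)
have /choice[R RE] (cb : A * B) :
    exists x, forall b', p x b' = p cb.1 (cb.2 * b').
  by have [x xE] := repA (p_mulr cb.1 cb.2); exists x => b'; rewrite xE.
have /choice[S' S'E] b : exists b', forall a, p a b' = p (S a) b.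
  have [|b' b'E] := repB (w := fun a => p (S a) b); last by exists b'.
  by move=> k x y; rewrite S_lin p_linl.
have S'F b c : S' b * F c = F (R (c, b)).
  (* The functionals slicing the two sides of the relation for [S] are [phi (x * c)], represented by
     [F c], and [phi (a * x)], represented by [b']. *)
  apply: pairing_injr => a; have [b' b'E] := repB (phi_mull a).
  rewrite FE b'E RE /=.
  have := congr1 (p^~ b) (S_antipode.2 a c).
  rewrite slice_r_mulr // slice_r_mull //.
  rewrite (pairing_slice_r (w := fun x => phi (a * x)) _ _ b'E) => <-.
  have wE x : phi (x * c) = p x (F c) by rewrite FE.
  by rewrite -S'E (pairing_slice_r (w := fun x => phi (x * c)) _ _ wE).
have psiS' b d : psi (S' b * d) = p (E d) b.
  by rewrite -{1}[d]EK S'F psiF RE mulr1.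
have S'_lin : linear S'.
  by move=> k x y; apply: pairing_injr => a; rewrite p_linr !S'E p_linr.
have S'_bij : bijective S'.
  (* The inverse is the adjoint of [T], whose linearity is checked after applying the injective
     [S]. *)
  have /choice[T' T'E] b : exists b', forall a, p a b' = p (T a) b.
    have [|b' b'E] := repB (w := fun a => p (T a) b); last by exists b'.
    move=> k x y; rewrite -p_linl; congr (p _ b).
    by apply: (can_inj ST); rewrite S_lin !TS.
  by exists T' => b; apply: pairing_injr => a;
    rewrite ?S'E T'E ?S'E ?ST ?TS.
have S'_mul x y : S' (x * y) = S' y * S' x.
  (* Both sides are multiplied by [1 = F (E 1)]: acting on [E 1] by [x * y] is acting by [x], then
     by [y]. *)
  rewrite -[LHS]mulr1 -[RHS]mulr1 -[1]EK -mulrA !S'F; congr F.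
  by apply: pairing_injl => b; rewrite !RE /= mulrA.
have [T' S'K T'K] := S'_bij.
have psi_mull b : scalar (fun x => psi (b * x)).
  by move=> k x y; rewrite mulrDr -scalerAr psi_lin.
have psi_mulr b : scalar (fun x => psi (x * b)).
  by move=> k x y; rewrite mulrDl -scalerAl psi_lin.
have S'_antipode : right_antipode (coproductB p) psi S'.
  (* Writing [c] as [S' b] puts the functional on the left side in the form that [psiS']
     evaluates. *)
  split=> // a c; rewrite -(T'K c); set b := T' c; apply: pairing_injr => x.
  have [y yE] := repA (psi_mull (S' b)).
  have [y' y'E] := repA (psi_mulr a).
  (* [e] absorbs left multiplication by [S x], so that [psiS'], used at [e], evaluates the right
     side as well. *)
  have [|e eE] := repB (w := fun z => p (S x * z) b).
    by move=> k u v; rewrite mulrDr -scalerAr p_linl.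
  rewrite S'E slice_l_mulr // slice_l_mull //.
  rewrite (pairing_slice_l (w := fun z => psi (S' b * z)) _ _ yE).
  rewrite (pairing_slice_l (w := fun z => psi (z * a)) _ _ y'E).
  transitivity (p (S x * E a) b).
    by rewrite EE -mulrA -FE -yE psiS' FK.
  by rewrite S'E S_mul !eE -S'E -y'E psiS'.
split=> //; last by exists S'; split.
(* By [psiS'], each half of faithfulness is a half of nondegeneracy, transported through the
   bijections [S'] and [F]. *)
split=> [b b0|d d0].
  rewrite -[b]T'K; have -> : T' b = 0.
    by apply: p_nondeg.2 => c; rewrite -[c]FK -psiS' T'K b0.
  by apply: pairing_injr => a;
    rewrite S'E -[0](scale0r 0) !(scalar_scale _ _ (p_linr _)) !mul0r.
rewrite -[d]EK; have -> : E d = 0 by apply: p_nondeg.1 => b; rewrite -psiS' d0.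
apply: p_nondeg.2 => a; rewrite FE mulr0.
by rewrite -[X in phi X](scale0r 0) scalar_scale // mul0r.
Qed.

End Duality.

(** * Specialization to complex coefficients *)

Theorem theorem2p11 (R : realType) (A B : falgType R[i])
    (p : {bilinear A -> B -> R[i] | *%R & *%R})
    (p_nondeg : nondegenerate_pairing p)
    (phi : A -> R[i])
    (phi_left : left_integral (coproductA p) phi)
    (phi_faithful : faithful phi)
    (S : A -> A)
    (S_antipode : left_antipode (coproductA p) phi S)
    (S_anti : anti_isomorphism S) :
  let psi := dual_integral p phi in
  [/\ right_integral (coproductB p) psi,
      faithful psi &
      exists S' : B -> B,
        [/\ forall (a : A) (b : B), p a (S' b) = p (S a) b,
            right_antipode (coproductB p) psi S' &
            anti_isomorphism S']].
Proof.
move=> psi.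
have p_linl b : scalar (p^~ b) by move=> k x y; rewrite linearPl.
have p_linr a : scalar (p a) by move=> k x y; rewrite linearPr.
have [psi_lin psi_faithful [S' S'P]] := dual_integral_faithful_right_antipode
  p_linl p_linr p_nondeg phi_left.1 phi_faithful S_antipode S_anti.
split=> //; last by exists S'.
by split=> //; exists S'; case: S'P.
Qed.
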